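(* For the periodic quantum graph of the elongated triangular tiling with edge length $a$ and potentials $q_1,\dots,q_5$ on its five classes of edges, the characteristic function is, with $\widetilde\alpha=e^{i\theta_1}$ and $\beta=e^{-i\theta_2}$, $$\begin{aligned}\Phi(\rho)=-\widetilde\alpha^4\beta\big\{&(S_1S_2S_3S_4)'(C_5+S_5'-2\cos\theta_1)+(CSSS)_{1345}(S_2'+C_2-2\cos\theta_1)\\&+S_1S_2S_5\big((C_4S_3)'+(C_3S_4)'-2\cos\theta_1\big)+S_2S_3S_5\big((C_1S_4)'+S_1'C_4-2\cos(\theta_1-\theta_2)\big)\\&+S_2S_4S_5\big(S_1'C_3+C_1S_3'-2\cos\theta_2\big)\\&+S_1S_3S_4\big(C_2S_5'-S_2'C_5-2(C_2+S_5')\cos\theta_1+4\cos^2\theta_1\big)\big\}.\end{aligned}$$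
   Context: Let $a>0$, $q_1,\dots,q_5\in L^2(0,a)$ real-valued (not assumed identical or even), $\rho\in\mathbb C$, $\lambda=\rho^2$. Let $C_j(x,\rho),S_j(x,\rho)$ be the solutions of $-y''+q_jy=\rho^2y$ on $[0,a]$ with $C_j(0,\rho)=S_j'(0,\rho)=1$, $C_j'(0,\rho)=S_j(0,\rho)=0$; abbreviate $C_j=C_j(a,\rho)$, $C_j'=C_j'(a,\rho)$, $S_j=S_j(a,\rho)$, $S_j'=S_j'(a,\rho)$. A prime on a product denotes the product rule, e.g. $(C_4S_3)'=C_4'S_3+C_4S_3'$, and $(S_1S_2S_3S_4)'=S_1'S_2S_3S_4+S_1S_2'S_3S_4+S_1S_2S_3'S_4+S_1S_2S_3S_4'$. Also $(CSSS)_{1345}=C_1S_3S_4S_5+C_3S_1S_4S_5+C_4S_1S_3S_5+C_5S_1S_3S_4$. The graph is periodic with respect to $\vec k_1=(a,0)$, $\vec k_2=(\frac a2,(1+\frac{\sqrt3}2)a)$; modulo translations it has vertices $v_1,v_2$ and edges $e_1:v_2-\vec k_1+\vec k_2\to v_1$, $e_2:v_1-\vec k_1\to v_1$, $e_3:v_2-\vec k_1\to v_1$, $e_4:v_2\to v_1$, $e_5:v_2-\vec k_1\to v_2$, each parametrized by $[0,a]$ in the indicated direction and carrying potential $q_j$. For a quasi-momentum $\Theta=(\theta_1,\theta_2)\in[-\pi,\pi]^2$, the Bloch Hamiltonian $H^\Theta$ acts as $-y''+q_jy$ on edges, on functions satisfying the continuity–Kirchhoff condition at vertices and $y(x+p_1\vec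 k_1+p_2\vec k_2)=e^{i(p_1\theta_1+p_2\theta_2)}y(x)$, $p_1,p_2\in\mathbb Z$. Writing $y_j=A_jC_j(x,\rho)+B_jS_j(x,\rho)$ on $e_j$, these conditions become a homogeneous linear system in the unknowns ordered $(A_1,\dots,A_5,B_1,\dots,B_5)$. The characteristic function $\Phi(\rho)$ is the determinant of the $10\times10$ matrix whose rows are, in order, the coefficients of the linear forms 1. $C_1A_1-\widetilde\alpha A_2+S_1B_1$ 2. $(C_2-\widetilde\alpha)A_2+S_2B_2$ 3. $-\widetilde\alpha A_2+C_3A_3+S_3B_3$ 4. $-\widetilde\alpha A_2+C_4A_4+S_4B_4$ 5. $C_1'A_1+C_2'A_2+C_3'A_3+C_4'A_4+S_1'B_1+(S_2'-\widetilde\alpha)B_2+S_3'B_3+S_4'B_4$ 6. $-A_4+C_5A_5+S_5B_5$ 7. $\widetilde\alpha A_3-A_4$ 8. $-A_4+\widetilde\alpha A_5$ 9. $\widetilde\alpha\beta A_1-A_4$ 10. $-C_5'A_5+\widetilde\alpha\beta B_1+\widetilde\alpha B_3+B_4+(\widetilde\alpha-S_5')B_5$. Thus $\rho^2\in\sigma(H^\Theta)$ if and only if $\Phi(\rho)=0$. *)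

(* Defs.v *)
From mathcomp Require Import all_boot all_order all_algebra.
From mathcomp Require Import complex.
From mathcomp Require Import all_classical all_reals all_analysis.
Import Order.TTheory GRing.Theory Num.Theory.
Import numFieldNormedType.Exports.

Set Implicit Arguments.
Unset Strict Implicit.
Unset Printing Implicit Defensive.

Local Open Scope classical_set_scope.
Local Open Scope complex_scope.
Local Open Scope ring_scope.

(* Lfun is not used for L^2(0, a): it asks for measurability on the whole
   line, whereas only the restriction of q to (0, a) is meaningful here. *)
Definition L2_interval (R : realType) (a : R) (q : R -> R) : Prop :=
  measurable_fun `]0, a[ q /\
  (\int[lebesgue_measure]_(x in `]0%R, a[) ((q x ^+ 2)%R)%:E < +oo)%E.

(* R[i] is not a normed module over R, so the derivative of a complex-valued
   function of a real variable is written as the limit of its difference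
   quotients. It is taken within D, hence one-sided at the ends of an interval. *)
Definition has_derivative_within (R : realType) (D : set R) (f : R -> R[i])
    (x : R) (l : R[i]) : Prop :=
  (f t - f x) / (t - x)%:C @[t --> within D x^'] --> (l : R[i]^o).

(* `|z| has type R[i] for z : R[i], hence the cast of eps. *)
Definition absolutely_continuous (R : realType) (a b : R) (f : R -> R[i]) : Prop :=
  forall eps : R, 0 < eps -> exists2 delta : R, 0 < delta &
    forall (n : nat) (u v : 'I_n -> R),
      (forall i, [/\ a <= u i, u i <= v i & v i <= b]) ->
      trivIset setT (fun i => `]u i, v i[%classic) ->
      \sum_(i < n) (v i - u i) < delta ->
      \sum_(i < n) `|f (v i) - f (u i)| < eps%:C.

(* For q in L^2 only, -y'' + q y = lambda y is understood almost everywhere,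
   with y continuously differentiable and y' absolutely continuous on [0, a];
   dy is y'. *)
Definition SL_solution (R : realType) (a : R) (q : R -> R) (lambda : R[i])
    (y dy : R -> R[i]) : Prop :=
  [/\ forall x, x \in `[0, a] -> has_derivative_within `[0, a] y x (dy x),
      absolutely_continuous 0 a dy &
      {ae lebesgue_measure, forall x, x \in `]0, a[ ->
        exists2 ddy : R[i], has_derivative_within `[0, a] dy x ddy &
          - ddy + (q x)%:C * y x = lambda * y x}].

Definition expi (R : realType) (t : R) : R[i] := cos t +i* sin t.

(* The five edges of the fundamental cell, as elements of 'I_5. *)
Definition e1 : 'I_5 := @Ordinal 5 0 isT.
Definition e2 : 'I_5 := @Ordinal 5 1 isT.
Definition e3 : 'I_5 := @Ordinal 5 2 isT.
Definition e4 : 'I_5 := @Ordinal 5 3 isT.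
Definition e5 : 'I_5 := @Ordinal 5 4 isT.

(* The quasi-periodic vertex conditions of the graph with edges
     e1 : v2 - k1 + k2 -> v1,  e2 : v1 - k1 -> v1,  e3 : v2 - k1 -> v1,
     e4 : v2 -> v1,            e5 : v2 - k1 -> v2,
   as linear forms in the coefficients of y_j = A_j C_j + B_j S_j, where
   z = (A_1, ..., A_5, B_1, ..., B_5), alpha = e^(i theta1) and
   beta = e^(-i theta2). The arguments C, C', S, S' are the values at x = a.
   The first four forms express continuity at v1 and the fifth one the
   Kirchhoff condition there; the last five do the same at v2. *)
Definition vertex_forms (K : comNzRingType) (alpha beta : K)
    (C C' S S' : 'I_5 -> K) (z : 'rV[K]_(5 + 5)) : seq K :=
  let A j := z 0 (lshift 5 j) in
  let B j := z 0 (rshift 5 j) in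
  [:: C e1 * A e1 - alpha * A e2 + S e1 * B e1;
      (C e2 - alpha) * A e2 + S e2 * B e2;
      - alpha * A e2 + C e3 * A e3 + S e3 * B e3;
      - alpha * A e2 + C e4 * A e4 + S e4 * B e4;
      C' e1 * A e1 + C' e2 * A e2 + C' e3 * A e3 + C' e4 * A e4
        + S' e1 * B e1 + (S' e2 - alpha) * B e2 + S' e3 * B e3 + S' e4 * B e4;
      - A e4 + C e5 * A e5 + S e5 * B e5;
      alpha * A e3 - A e4;
      - A e4 + alpha * A e5;
      alpha * beta * A e1 - A e4;
      - C' e5 * A e5 + alpha * beta * B e1 + alpha * B e3 + B e4
        + (alpha - S' e5) * B e5].

Definition characteristic_mx (K : comNzRingType) (alpha beta : K)
    (C C' S S' : 'I_5 -> K) : 'M[K]_(5 + 5) :=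
  \matrix_(i, j) (vertex_forms alpha beta C C' S S' (delta_mx 0 j))`_i.

Definition characteristic_function (R : realType) (theta1 theta2 : R)
    (C C' S S' : 'I_5 -> R[i]) : R[i] :=
  \det (characteristic_mx (expi theta1) (expi (- theta2)) C C' S S').

(* Main.v *)
(** Modulo the Wronskian relations [C_j S_j' - C_j' S_j = 1], all five of which
    are needed, the formula is a polynomial identity. As the potentials are only
    square integrable, the Wronskian is an absolutely continuous function whose
    derivative vanishes almost everywhere; such a function is constant by a
    gauge argument: cut [[a, b]] into small intervals around tags, those with
    tags where the derivative vanishes contribute at most [e (b - a)], and the
    others lie in an open set of small measure, so that absolute continuity
    bounds their total contribution. *)
Require Import Defs.
From mathcomp Require Import all_boot all_order all_algebra.
From mathcomp Require Import complex.
From mathcomp Require Import all_classical all_reals all_analysis.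
From mathcomp Require Import measurable_realfun ring lra.
Import Order.TTheory GRing.Theory Num.Theory.
Import numFieldNormedType.Exports.
Import Normc.

Set Implicit Arguments.
Unset Strict Implicit.
Unset Printing Implicit Defensive.

Local Open Scope classical_set_scope.
Local Open Scope complex_scope.
Local Open Scope ring_scope.

(** * Real-valued modulus of complex numbers *)

Section ComplexNorm.
Variable R : realType.
Implicit Types (x y : R[i]) (t : R).

Lemma normrE x : `|x| = (normc x)%:C. Proof. by []. Qed.

Lemma normc_ge0 x : 0 <= normc x.
Proof. by rewrite -ler0c -normrE. Qed.

Lemma normc_triangle x y : normc (x + y) <= normc x + normc y.
Proof. exact: le_normcD. Qed.

Lemma normc_opp x : normc (- x) = normc x.
Proof. exact: normcN. Qed.

Lemma normc_sub x y : normc (x - y) <= normc x + normc y.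
Proof. by rewrite (le_trans (normc_triangle _ _))// normc_opp. Qed.

Lemma normc_real t : normc t%:C = `|t|.
Proof. by rewrite /= expr0n addr0 sqrtr_sqr. Qed.

End ComplexNorm.

(* Cousin's lemma, phrased as an induction principle. *)
Lemma interval_gauge_ind (R : realType) (a b : R) (P : R -> R -> Prop) :
  a <= b ->
  (forall u v w, a <= u -> u <= v -> v <= w -> w <= b ->
    P u v -> P v w -> P u w) ->
  (forall x, a <= x <= b -> exists2 d, 0 < d &
    forall u v, a <= u -> v <= b -> x - d < u -> u <= x -> x <= v ->
      v < x + d -> P u v) ->
  P a b.
Proof.
move=> ab Ptrans Ploc.
pose A := [set x | a <= x <= b /\ P a x].
have Aa : A a.
  split; first by rewrite lexx.
  have [|d d0 Pd] := Ploc a; first by rewrite lexx.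
  by apply: Pd; rewrite // ?lexx //; lra.
have ubA : ubound A b by move=> x [/andP[]].
have hsA : has_sup A by split; [exists a|exists b].
have as_ : a <= sup A by apply: ub_le_sup => //; exists b.
have sb : sup A <= b by apply: ge_sup => //; exists a.
have [|d d0 Pd] := Ploc (sup A); first by rewrite as_.
have [x [/andP[ax xb] Pax] sx] := sup_adherent d0 hsA.
have xs : x <= sup A by apply: ub_le_sup; [exists b|split=> //; rewrite ax].
have Pv v : sup A <= v -> v <= b -> v < sup A + d -> P a v.
  move=> sv vb vd; apply: (Ptrans a x v) => //; first exact: le_trans xs sv.
  exact: Pd.
have [sb'|bs] := ltP (sup A) b; last first.
  by apply: Pv => //; lra.
(* If [sup A < b], half the gauge at [sup A] reaches a point of [A] beyond it; the cap at [b] keeps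
   that point in the interval. *)
pose v := Num.min b (sup A + d / 2).
have vb : v <= b by rewrite ge_min lexx.
have sv : sup A < v by rewrite lt_min sb' /=; lra.
have vd : v < sup A + d by rewrite gt_min; apply/orP; right; lra.
have : A v by split; [rewrite vb (le_trans as_ (ltW sv))|exact: (Pv _ (ltW sv))].
by move/(ub_le_sup (ex_intro _ b ubA)); rewrite leNgt sv.
Qed.

(** * Derivatives within a set *)

Section DerivativeWithin.
Variable R : realType.
Implicit Types (D : set R) (f g : R -> R[i]) (x : R) (l m : R[i]).

(** Clearing the denominator leaves a linear approximation error with real bounds, meaningful also
    at [t = x]; the difference and product rules then reduce to triangle inequalities. *)
Lemma has_derivative_withinP D f x l :
  has_derivative_within D f x l <->
  forall e, 0 < e -> exists2 d, 0 < d & forall t, D t -> `|t - x| < d ->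
    normc (f t - f x - (t - x)%:C * l) <= e * `|t - x|.
Proof.
have key t (e : R) : t != x ->
    (`|l - (f t - f x) / (t - x)%:C| <= e%:C) =
    (normc (f t - f x - (t - x)%:C * l) <= e * `|t - x|).
  move=> tx; have tx0 : t - x != 0 by rewrite subr_eq0.
  have tx0' : (t - x)%:C != 0 :> R[i].
    by apply: contra tx0 => /eqP h; apply/eqP/complexI.
  have -> : l - (f t - f x) / (t - x)%:C =
      - (f t - f x - (t - x)%:C * l) / (t - x)%:C.
    by move: (t - x)%:C tx0' => z z0; field.
  rewrite normrE lecR normcM normc_opp normcV normc_real.
  by rewrite ler_pdivrMr// normr_gt0.
have cvgP := @cvgrPdist_le R[i] R[i]^o R (within D x^') _
  (fun t => (f t - f x) / (t - x)%:C) l.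
split=> [/cvgP h e e0|h].
  have /h : 0 < e%:C by rewrite ltcR.
  rewrite near_withinE.
  move=> /nbhs_ballP[d /= d0 hd]; exists d => // t Dt td.
  have [->|tx] := eqVneq t x.
    by rewrite !subrr normr0 mulr0 mul0r subrr normc0.
  rewrite -key//; apply: hd => //; rewrite /ball /= distrC //.
apply/cvgP => e e0.
(* A positive element of [R[i]] is real, so a complex tolerance reduces to a real one. *)
have [r er] : exists r : R, e = r%:C.
  by apply/complex_realP; rewrite realE ltW.
move: e0; rewrite er ltcR => r0.
have [d d0 hd] := h r r0.
rewrite near_withinE; apply/nbhs_ballP; exists d => //= t.
rewrite /ball /= distrC => td Dt tx.
by rewrite key//; apply: hd.
Qed.

Lemma has_derivative_withinB (D : set R) f g x l m :
  has_derivative_within D f x l -> has_derivative_within D g x m ->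
  has_derivative_within D (fun t => f t - g t) x (l - m).
Proof.
move=> /has_derivative_withinP fl /has_derivative_withinP gm.
apply/has_derivative_withinP => e e0.
have e20 : 0 < e / 2 by rewrite divr_gt0.
have [d d0 hf] := fl _ e20; have [d' d'0 hg] := gm _ e20.
exists (Num.min d d') => [|t Dt]; first by rewrite lt_min d0.
rewrite lt_min => /andP[td td'].
have -> : f t - g t - (f x - g x) - (t - x)%:C * (l - m) =
  (f t - f x - (t - x)%:C * l) - (g t - g x - (t - x)%:C * m).
  by move: (t - x)%:C => z; ring.
apply: le_trans (normc_sub _ _) _.
have := lerD (hf t Dt td) (hg t Dt td'); rewrite -mulrDl; lra.
Qed.

Lemma has_derivative_withinM (D : set R) f g x l m :
  has_derivative_within D f x l -> has_derivative_within D g x m ->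
  has_derivative_within D (fun t => f t * g t) x (l * g x + f x * m).
Proof.
move=> /has_derivative_withinP fl /has_derivative_withinP gm.
apply/has_derivative_withinP => e e0.
(* [k] controls the two first-order errors, [k'] the product of the two increments, which is of
   second order in [t - x]. *)
pose k := normc (f x) + normc (g x) + 1.
pose k' := (1 + normc l) * (1 + normc m).
have [f0 g0 l0 m0] :
    [/\ 0 <= normc (f x), 0 <= normc (g x), 0 <= normc l & 0 <= normc m].
  by split; exact: normc_ge0.
have k0 : 0 < k by rewrite /k; lra.
have k'0 : 0 < k' by rewrite /k'; apply: mulr_gt0; lra.
pose e1 := Num.min 1 (e / 2 / k).
have e10 : 0 < e1 by rewrite lt_min ltr01 !divr_gt0.
have e11 : e1 <= 1 by rewrite ge_min lexx.
have e1k : e1 * k <= e / 2.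
  by rewrite -ler_pdivlMr// ge_min lexx orbT.
have [d d0 hf] := fl _ e10; have [d' d'0 hg] := gm _ e10.
exists (Num.min (Num.min d d') (e / 2 / k')) => [|t Dt].
  by rewrite !lt_min d0 d'0 !divr_gt0.
rewrite !lt_min => /andP[/andP[td td'] tk].
move: (hf t Dt td) (hg t Dt td').
set F := f t - _ - _; set G := g t - _ - _ => hF hG.
have -> : f t * g t - f x * g x - (t - x)%:C * (l * g x + f x * m) =
  (F * g x + f x * G) + (F + (t - x)%:C * l) * (G + (t - x)%:C * m).
  by rewrite /F /G; move: (t - x)%:C => z; ring.
have hFl : normc (F + (t - x)%:C * l) <= (1 + normc l) * `|t - x|.
  apply: le_trans (normc_triangle _ _) _.
  rewrite normcM normc_real mulrDl mulrC lerD//.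
  by rewrite (le_trans hF)// ler_wpM2r.
have hGm : normc (G + (t - x)%:C * m) <= (1 + normc m) * `|t - x|.
  apply: le_trans (normc_triangle _ _) _.
  rewrite normcM normc_real mulrDl mulrC lerD//.
  by rewrite (le_trans hG)// ler_wpM2r.
apply: le_trans (normc_triangle _ _) _.
have h1 : normc (F * g x + f x * G) <= e / 2 * `|t - x|.
  apply: le_trans (normc_triangle _ _) _; rewrite !normcM.
  have := ler_wpM2r g0 hF; have := ler_wpM2l f0 hG.
  have := ler_wpM2r (normr_ge0 (t - x)) e1k.
  have := mulr_ge0 (ltW e10) (normr_ge0 (t - x)).
  rewrite /k; nra.
have h2 : normc ((F + (t - x)%:C * l) * (G + (t - x)%:C * m)) <=
    e / 2 * `|t - x|.
  rewrite normcM.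
  apply: le_trans (ler_pM (normc_ge0 _) (normc_ge0 _) hFl hGm) _.
  rewrite mulrACA -/k' mulrA ler_wpM2r// mulrC -ler_pdivlMr//; exact: ltW.
have := lerD h1 h2; rewrite -mulrDl; lra.
Qed.

End DerivativeWithin.

(** * Absolutely continuous functions on a compact interval *)

Section AbsoluteContinuity.
Variables (R : realType) (a b : R).
Hypothesis ab : a <= b.
Implicit Types (f g : R -> R[i]) (l m : R[i]) (x : R).

Lemma absolutely_continuousP f :
  absolutely_continuous a b f <->
  forall e, 0 < e -> exists2 d, 0 < d &
    forall (n : nat) (u v : 'I_n -> R),
      (forall i, [/\ a <= u i, u i <= v i & v i <= b]) ->
      trivIset setT (fun i => `]u i, v i[%classic) ->
      \sum_(i < n) (v i - u i) < d ->
      \sum_(i < n) normc (f (v i) - f (u i)) < e.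
Proof.
split=> h e e0; have [d d0 hd] := h e e0; exists d => // n u v uv tuv suv.
  by have := hd n u v uv tuv suv; rewrite -(rmorph_sum (real_complex R)) ltcR.
by rewrite -(rmorph_sum (real_complex R)) ltcR hd.
Qed.

Lemma absolutely_continuousB f g :
  absolutely_continuous a b f -> absolutely_continuous a b g ->
  absolutely_continuous a b (fun x => f x - g x).
Proof.
move=> /absolutely_continuousP hf /absolutely_continuousP hg.
apply/absolutely_continuousP => e e0.
have e20 : 0 < e / 2 by rewrite divr_gt0.
have [d d0 {}hf] := hf _ e20; have [d' d'0 {}hg] := hg _ e20.
exists (Num.min d d') => [|n u v uv tuv]; first by rewrite lt_min d0.
rewrite lt_min => /andP[sd sd'].
have := ltrD (hf n u v uv tuv sd) (hg n u v uv tuv sd').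
rewrite -splitr -big_split; apply: le_lt_trans; apply: ler_sum => i _ /=.
rewrite (_ : _ - _ - _ = f (v i) - f (u i) - (g (v i) - g (u i))); last by ring.
exact: normc_sub.
Qed.

Lemma absolutely_continuous_uniform f e :
  absolutely_continuous a b f -> 0 < e -> exists2 d, 0 < d &
    forall u v, a <= u -> u <= v -> v <= b -> v - u < d ->
      normc (f v - f u) < e.
Proof.
move=> /absolutely_continuousP hf /hf[d d0 {}hf]; exists d => // u v au uv vb vud.
have := hf 1%N (fun=> u) (fun=> v); rewrite !big_ord1; apply=> //.
by move=> i j _ _ _; rewrite !ord1.
Qed.

(** By uniform continuity [f] varies by less than 1 on short intervals; the local bounds are glued
    by taking maxima. *)
Lemma absolutely_continuous_bounded f :
  absolutely_continuous a b f -> exists M, forall x, a <= x <= b -> normc (f x) <= M.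
Proof.
move=> /absolutely_continuous_uniform/(_ ltr01)[d d0 hf].
apply: (@interval_gauge_ind R a b (fun u v => exists M, forall x, u <= x <= v ->
  normc (f x) <= M)) => //.
  move=> u v w _ uv vw _ [M hM] [M' hM']; exists (Num.max M M') => x /andP[ux xw].
  rewrite le_max; have [xv|vx] := leP x v; first by rewrite hM// ux.
  by rewrite hM' ?orbT// xw (ltW vx).
move=> x /andP[ax xb]; exists d => // u v au vb xu ux xv vx.
exists (normc (f x) + 1) => t /andP[ut tv].
suff h : normc (f t - f x) <= 1.
  rewrite -(subrK (f x) (f t)) (le_trans (normc_triangle _ _))// addrC lerD2l.
  exact: h.
have [tx|xt] := leP t x.
  by rewrite -normc_opp opprB ltW// hf//; lra.
by rewrite ltW// hf//; lra.
Qed.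

Lemma absolutely_continuousM f g :
  absolutely_continuous a b f -> absolutely_continuous a b g ->
  absolutely_continuous a b (fun x => f x * g x).
Proof.
move=> hf hg.
have [M hM] := absolutely_continuous_bounded hf.
have [N hN] := absolutely_continuous_bounded hg.
have M0 : 0 <= M by apply: le_trans (hM a _); rewrite ?normc_ge0 ?lexx.
have N0 : 0 <= N by apply: le_trans (hN a _); rewrite ?normc_ge0 ?lexx.
move: hf hg => /absolutely_continuousP hf /absolutely_continuousP hg.
apply/absolutely_continuousP => e e0.
(* With [M] and [N] bounding [f] and [g], the product varies by at most [(M + N) * e1], which stays
   below [e]. *)
pose e1 := e / 2 / (M + N + 1).
have MN0 : 0 < M + N + 1 by lra.
have e10 : 0 < e1 by rewrite !divr_gt0.
have [d d0 {}hf] := hf _ e10; have [d' d'0 {}hg] := hg _ e10.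
exists (Num.min d d') => [|n u v uv tuv]; first by rewrite lt_min d0.
rewrite lt_min => /andP[sd sd'].
have {}hf := hf n u v uv tuv sd; have {}hg := hg n u v uv tuv sd'.
apply: (@le_lt_trans _ _ (N * \sum_(i < n) normc (f (v i) - f (u i)) +
    M * \sum_(i < n) normc (g (v i) - g (u i)))).
  rewrite !mulr_sumr -big_split; apply: ler_sum => i _ /=.
  have [au uvi vb] := uv i.
  rewrite (_ : _ - _ = (f (v i) - f (u i)) * g (v i) +
    f (u i) * (g (v i) - g (u i))); last by ring.
  apply: le_trans (normc_triangle _ _) _; rewrite !normcM [N * _]mulrC.
  apply: lerD; first by rewrite ler_wpM2l ?normc_ge0// hN// vb (le_trans au).
  by rewrite ler_wpM2r ?normc_ge0// hM// au (le_trans uvi).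
have e1E : e1 * (M + N + 1) = e / 2 by rewrite /e1 divfK ?gt_eqF.
have := ler_wpM2l N0 (ltW hf); have := ler_wpM2l M0 (ltW hg); nra.
Qed.

(** Such an [f] is Lipschitz. The inequality comes from gauge induction, since the mean value
    equality fails for complex values. *)
Lemma absolutely_continuous_bounded_derivative f f' M :
  (forall x, x \in `[a, b] -> has_derivative_within `[a, b] f x (f' x)) ->
  (forall x, a <= x <= b -> normc (f' x) <= M) ->
  absolutely_continuous a b f.
Proof.
move=> hf hM.
have M0 : 0 <= M by apply: le_trans (hM a _); rewrite ?normc_ge0 ?lexx.
(* The extra 1 in the constant absorbs the error of the linear approximation, taken with tolerance
   1. *)
have lip u v : a <= u -> u <= v -> v <= b ->
    normc (f v - f u) <= (M + 1) * (v - u).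
  move=> au uv vb.
  apply: (@interval_gauge_ind R u v (fun s t => normc (f t - f s) <= (M + 1) * (t - s)))
      => // [r s t _ _ _ _ hrs hst|x /andP[ux xv]].
    rewrite (_ : f t - f r = (f t - f s) + (f s - f r)); last by ring.
    apply: le_trans (normc_triangle _ _) _.
    by apply: le_trans (lerD hst hrs) _; rewrite -mulrDr; lra.
  have xab : a <= x <= b by rewrite (le_trans au)//= (le_trans xv).
  have /hf/has_derivative_withinP/(_ _ ltr01)[d d0 hd] : x \in `[a, b].
    by rewrite in_itv.
  exists d => // s t us tv xs sx xt tx.
  have near_x y : u <= y -> y <= v -> `|y - x| < d ->
      normc (f y - f x) <= (M + 1) * `|y - x|.
    move=> uy yv yx.
    have yab : `[a, b]%classic y by rewrite /= in_itv /= (le_trans au)//= (le_trans yv).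
    have := hd y yab yx; rewrite mul1r => h.
    rewrite -(subrK ((y - x)%:C * f' x) (f y - f x)).
    apply: le_trans (normc_triangle _ _) _.
    rewrite normcM normc_real mulrDl mul1r addrC lerD// mulrC.
    by rewrite ler_wpM2r// hM.
  rewrite (_ : f t - f s = (f t - f x) - (f s - f x)); last by ring.
  apply: le_trans (normc_sub _ _) _.
  have := near_x t; rewrite ger0_norm ?subr_ge0// => h1.
  have := near_x s; rewrite ler0_norm ?subr_le0// => h2.
  apply: le_trans (lerD (h1 _ _ _) (h2 _ _ _)) _; rewrite -?mulrDr; lra.
apply/absolutely_continuousP => e e0; have M10 : 0 < M + 1 by lra.
exists (e / (M + 1)) => [|n u v uv _]; first exact: divr_gt0.
rewrite ltr_pdivlMr// mulrC; apply: le_lt_trans; rewrite mulr_sumr.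
by apply: ler_sum => i _; have [? ? ?] := uv i; exact: lip.
Qed.

End AbsoluteContinuity.

(** * Functions whose derivative vanishes almost everywhere *)

(** By additivity the total length is the measure of the union, which lies in [U]. Disjointness is
    part of the conclusion because absolute continuity asks for it. *)
Lemma sum_pairwise_itv_le (R : realType) (U : set R) (s : seq (R * R)) :
  measurable U ->
  all (fun p => p.1 <= p.2) s ->
  pairwise (fun p r => p.2 <= r.1) s ->
  (forall p, p \in s -> `]p.1, p.2[%classic `<=` U) ->
  ((\sum_(i < size s) ((nth (0, 0) s i).2 - (nth (0, 0) s i).1))%:E <=
    lebesgue_measure U)%E /\
  trivIset setT (fun i : 'I_(size s) =>
    `](nth (0, 0) s i).1, (nth (0, 0) s i).2[%classic).
Proof.
move=> mU /all_nthP s12 /(pairwiseP (0, 0)) sp sU.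
pose I (i : 'I_(size s)) := `](nth (0, 0) s i).1, (nth (0, 0) s i).2[%classic.
have trI : trivIset setT I.
  have main (i j : 'I_(size s)) x : (i < j)%N -> I i x -> I j x -> False.
    move=> ij; rewrite /I /= !in_itv /= => /andP[_ xi] /andP[jx _].
    have := sp i j (ltn_ord i) (ltn_ord j) ij; rewrite /= leNgt.
    by rewrite (lt_trans jx xi).
  move=> i j _ _ [x [xi xj]]; apply/val_inj.
  by case: (ltngtP i j) => // ij; [case: (main i j x)|case: (main j i x)].
split=> //; rewrite -sumEFin.
rewrite (eq_bigr (fun i : 'I_(size s) => lebesgue_measure (I i))); last first.
  move=> i _; rewrite lebesgue_measure_itv /= lte_fin EFinB.
  have := s12 (0, 0) i (ltn_ord i); rewrite /= le_eqVlt => /orP[/eqP ->|->//].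
  by rewrite ltxx subee.
rewrite -(measure_bigsetU_ord lebesgue_measure xpredT) //.
- apply: le_measure; rewrite ?inE //.
    by apply: bigsetU_measurable => i _; exact: measurable_itv.
  apply: (@big_ind _ (fun X => X `<=` U)) => [//|A B AU BU|i _].
    by rewrite subUset.
  by apply: sU; rewrite mem_nth.
- by move=> i; exact: measurable_itv.
Qed.

Lemma absolutely_continuous_derivative0 (R : realType) (a b : R)
    (f : R -> R[i]) :
  a <= b -> absolutely_continuous a b f ->
  {ae lebesgue_measure, forall x, x \in `]a, b[ ->
    has_derivative_within `[a, b] f x 0} ->
  f b = f a.
Proof.
move=> ab /absolutely_continuousP fAC [N [mN N0 hN]].
(* The endpoints are added because the hypothesis only concerns ]a, b[. *)
pose Z := N `|` ([set a] `|` [set b]).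
have mZ : measurable Z by do 2! apply: measurableU => //.
have Z0 : lebesgue_measure Z = 0%E.
  have ab0 : lebesgue_measure ([set a] `|` [set b]) = 0%E.
    by rewrite measureU0 //; exact: lebesgue_measure_set1.
  by rewrite measureU0 ?N0 //; apply: measurableU.
have fd x : a <= x <= b -> ~ Z x -> has_derivative_within `[a, b] f x 0.
  move=> /andP[ax xb] nZ; apply: contrapT => nf; apply: nZ.
  have [<-|ax'] := eqVneq a x; first by right; left.
  have [->|xb'] := eqVneq x b; first by right; right.
  left; apply: hN => /= /(_ _)/nf; apply.
  by rewrite in_itv /= !lt_neqAle ax' ax xb' xb.
(* The added 1 leaves room for the subintervals with exceptional tags and keeps the factor
   positive. *)
suff small e : 0 < e -> normc (f b - f a) <= e * (b - a + 1).
  apply/eqP; rewrite -subr_eq0; apply/eqP/eq0_normc/eqP.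
  rewrite eq_le normc_ge0 andbT; apply/ler_addgt0Pr => e e0; rewrite add0r.
  have ba1 : 0 < b - a + 1 by lra.
  by have := small _ (divr_gt0 e0 ba1); rewrite divfK ?gt_eqF.
move=> e0; have [d d0 {}fAC] := fAC e e0.
have [|U [oU ZU ZUd]] := lebesgue_regularity_outer mZ _ d0.
  by rewrite [X in (X < _)%E]Z0.
have mU : measurable U by exact: open_measurable.
have Ud : (lebesgue_measure U < d%:E)%E.
  apply: le_lt_trans ZUd.
  (* [U] is the union of the null set [Z] and of [U] minus [Z], whose measure outer regularity makes
     smaller than [d]. *)
  rewrite -[X in (lebesgue_measure X <= _)%E](setDUK ZU).
  apply: le_trans (measureU2 _ _ _) _ => //; first exact: measurableD.
  by rewrite [X in (X + _)%E]Z0 add0e.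
(* [s] collects the subintervals whose tags lie in [Z]; all others are paid for by [e * (b - a)]. *)
have [s [sab sp sU fs]] : exists s : seq (R * R),
    [/\ all (fun p => [&& a <= p.1, p.1 <= p.2 & p.2 <= b]) s,
        pairwise (fun p r => p.2 <= r.1) s,
        forall p, p \in s -> `]p.1, p.2[%classic `<=` U &
        normc (f b - f a) <= e * (b - a) + \sum_(p <- s) normc (f p.2 - f p.1)].
  apply: (@interval_gauge_ind R a b (fun u v => exists s : seq (R * R),
    [/\ all (fun p => [&& u <= p.1, p.1 <= p.2 & p.2 <= v]) s,
        pairwise (fun p r => p.2 <= r.1) s,
        forall p, p \in s -> `]p.1, p.2[%classic `<=` U &
        normc (f v - f u) <= e * (v - u) + \sum_(p <- s) normc (f p.2 - f p.1)]))
    => //.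
    move=> u v w au uv vw wb [s [suv sp sU fs]] [s' [svw sp' sU' fs']].
    exists (s ++ s'); split.
    - rewrite all_cat; apply/andP; split.
        by apply: sub_all suv => p /and3P[-> -> pv] /=; rewrite (le_trans pv).
      by apply: sub_all svw => p /and3P[vp -> ->]; rewrite (le_trans uv).
    - rewrite pairwise_cat sp sp' !andbT; apply/allrelP => p r ps rs.
      have /and3P[_ _ pv] := allP suv p ps; have /and3P[vr _ _] := allP svw r rs.
      exact: le_trans pv vr.
    - by move=> p; rewrite mem_cat => /orP[/sU|/sU'].
    - rewrite big_cat /= (_ : f w - f u = (f w - f v) + (f v - f u)); last by ring.
      apply: le_trans (normc_triangle _ _) _.
      apply: le_trans (lerD fs' fs) _; rewrite le_eqVlt; apply/orP; left.
      by apply/eqP; ring.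
  (* At a tag in [Z] the gauge is the radius of a ball inside [U], and the subinterval is recorded
     in [s]. *)
  move=> x xab; have [xZ|xZ] := pselect (Z x).
    have /nbhs_ballP[r /= r0 rU] : nbhs x U by apply: open_nbhs_nbhs; split=> //; exact: ZU.
    exists r => // u v au vb xu ux xv vx; exists [:: (u, v)]; split=> //=.
    - by rewrite !lexx (le_trans ux xv).
    - move=> p; rewrite inE => /eqP -> /= y /=; rewrite in_itv /= => /andP[uy yv].
      by apply: rU; rewrite /ball /= ltr_norml; lra.
    - by rewrite big_seq1 lerDr mulr_ge0 ?(ltW e0)// subr_ge0 (le_trans ux).
  (* At any other tag the zero derivative bounds the increment by [e] times the length, and nothing
     is recorded. *)
  have /has_derivative_withinP/(_ e e0)[r r0 hr] := fd x xab xZ.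
  exists r => // u v au vb xu ux xv vx; exists [::]; split=> //.
  rewrite big_nil addr0 (_ : f v - f u = (f v - f x) - (f u - f x)); last by ring.
  apply: le_trans (normc_sub _ _) _.
  have := hr v; rewrite mulr0 subr0 ger0_norm ?subr_ge0// => h1.
  have := hr u; rewrite mulr0 subr0 ler0_norm ?subr_le0// => h2.
  have xab' := andP xab; case: xab' => ax xb.
  apply: le_trans (lerD (h1 _ _) (h2 _ _)) _; rewrite /= ?in_itv /=; lra.
have s12 : all (fun p : R * R => p.1 <= p.2) s.
  by apply: sub_all sab => p /and3P[].
have [sumU trU] := sum_pairwise_itv_le mU s12 sp sU.
apply: le_trans fs _.
(* [U] has measure below [d], so the recorded increments add up to less than [e]. *)
rewrite [e * (b - a + 1)]mulrDr mulr1 lerD2l (big_nth (0, 0)) big_mkord.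
apply/ltW/fAC => // [i|].
  by have /and3P[] := all_nthP (0, 0) sab i (ltn_ord i).
by rewrite -lte_fin (le_lt_trans sumU).
Qed.

(** In the derivative of [y * dz - dy * z] the terms [dy * dz] cancel, and the equation with common
    [q] and [lambda] cancels the rest almost everywhere. *)
Lemma wronskian_constant (R : realType) (a : R) (q : R -> R) (lambda : R[i])
    (y dy z dz : R -> R[i]) :
  0 <= a -> SL_solution a q lambda y dy -> SL_solution a q lambda z dz ->
  y a * dz a - dy a * z a = y 0 * dz 0 - dy 0 * z 0.
Proof.
move=> a0 [yd dyAC ydd] [zd dzAC zdd].
(* [y] and [z] are absolutely continuous too: their derivatives are absolutely continuous, hence
   bounded. *)
have AC f df : (forall x, x \in `[0, a] -> has_derivative_within `[0, a] f x (df x)) ->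
    absolutely_continuous 0 a df -> absolutely_continuous 0 a f.
  move=> fd /(absolutely_continuous_bounded a0)[M hM].
  exact: absolutely_continuous_bounded_derivative fd hM.
apply: (@absolutely_continuous_derivative0 R 0 a
  (fun x => y x * dz x - dy x * z x)) => //.
  apply: absolutely_continuousB; apply: absolutely_continuousM => //.
    exact: AC yd dyAC.
  exact: AC zd dzAC.
have aeF := ae_filter_ringOfSetsType (@lebesgue_measure R).
apply: (@filterS2 _ _ aeF _ _ _ _ ydd zdd) => x hy hz xa.
have [ddy dyd ey] := hy xa; have [ddz dzd ez] := hz xa.
have xa' : x \in `[0, a] by apply: subset_itv_oo_cc.
have -> : 0 = (dy x * dz x + y x * ddz) - (ddy * z x + dy x * dz x).
  have -> : ddy = (q x)%:C * y x - lambda * y x by rewrite -ey; ring.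
  have -> : ddz = (q x)%:C * z x - lambda * z x by rewrite -ez; ring.
  by ring.
exact: (has_derivative_withinB (has_derivative_withinM (yd x xa') dzd)
  (has_derivative_withinM dyd (zd x xa'))).
Qed.

(** * Complex exponentials of real angles *)

Section UnitComplexNumbers.
Variable R : realType.
Implicit Types s t : R.

Lemma expi0 : expi (0 : R) = 1.
Proof. by rewrite /expi cos0 sin0. Qed.

Lemma expiD s t : expi (s + t) = expi s * expi t.
Proof. by apply/eqP; rewrite eq_complex /= cosD sinD addrC eqxx addrC eqxx. Qed.

Lemma expiNr t : expi t * expi (- t) = 1.
Proof. by rewrite -expiD subrr expi0. Qed.

Lemma expi_addN t : expi t + expi (- t) = 2 * (cos t)%:C.
Proof.
rewrite mulr_natl mulr2n -rmorphD; apply/eqP.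
by rewrite eq_complex /= cosN sinN subrr !eqxx.
Qed.

End UnitComplexNumbers.

(** * Determinants of sparse matrices *)

Section SparseDeterminant.
Variable K : comNzRingType.

(* [None] stands for an entry or a minor that is zero; such branches of the
   Laplace expansion are pruned, which leaves 42 of the 10! terms. *)
Definition opt_add (x y : option K) : option K :=
  match x, y with
  | None, _ => y
  | _, None => x
  | Some a, Some b => Some (a + b)
  end.

Definition opt_signed_mul (sign : bool) (a : K) (y : option K) :=
  if y is Some b then Some (if sign then - (a * b) else a * b) else None.

(** This is [bump], the map skipping the index [j], written by structural recursion so that it
    evaluates on numerals. *)
Fixpoint shift_from (j k : nat) : nat :=
  match j, k with
  | 0%N, _ => k.+1
  | _, 0%N => 0%N
  | j'.+1, k'.+1 => (shift_from j' k').+1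
  end.

(** Entries are indexed by [nat] and a minor is a reindexing of [M], so no bound proofs obstruct
    evaluation. *)
Fixpoint sparse_det (n : nat) (M : nat -> nat -> option K) : option K :=
  if n is m.+1 then
    foldr (fun j => opt_add
      (if M 0%N j is Some a
       then opt_signed_mul (odd j) a
              (sparse_det m (fun i k => M i.+1 (shift_from j k)))
       else None)) None (iota 0 n)
  else Some 1.

Local Notation value := (oapp id (0 : K)).

Lemma shift_fromE j k : shift_from j k = bump j k.
Proof. by elim: j k => [|j IHj] [|k] //=; rewrite IHj bumpS. Qed.

Lemma opt_addE x y : value (opt_add x y) = value x + value y.
Proof. by case: x y => [a|] [b|] /=; rewrite ?addr0 ?add0r. Qed.

(** Both sides expand along the first row; a pruned branch has value zero, like the term it
    replaces. *)
Lemma sparse_detE n (M : nat -> nat -> option K) :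
  value (sparse_det n M) = \det (\matrix_(i < n, j < n) value (M i j)).
Proof.
elim: n M => [|n IHn] M; first by rewrite det_mx00.
have value_foldr (F : nat -> option K) s :
    value (foldr (fun j => opt_add (F j)) None s) = \sum_(j <- s) value (F j).
  by elim: s => [|j s IHs]; rewrite ?big_nil ?big_cons //= opt_addE IHs.
pose D j := sparse_det n (fun i k => M i.+1 (shift_from j k)).
have -> : sparse_det n.+1 M = foldr (fun j => opt_add
    (if M 0%N j is Some a then opt_signed_mul (odd j) a (D j) else None))
  None (iota 0 n.+1) by [].
rewrite (value_foldr (fun j => _)) -[iota 0 n.+1]/(index_iota 0 n.+1) big_mkord.
rewrite (expand_det_row _ ord0); apply: eq_bigr => j _.
rewrite mxE /cofactor add0n; set N := row' _ _.
have -> : \det N = value (D j).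
  rewrite IHn; congr (\det _); apply/matrixP => i k.
  by rewrite !mxE shift_fromE.
rewrite -signr_odd; case: (M 0%N j) => [a|] /=; last by rewrite mul0r.
case: (D j) => [b|] /=; last by rewrite !mulr0.
by case: odd; rewrite ?expr1 ?expr0 ?mulN1r ?mul1r ?mulrN.
Qed.

End SparseDeterminant.

(** * The characteristic determinant as a polynomial identity *)

Section CharacteristicIdentity.
Variables (K : comNzRingType) (alpha alphaV beta betaV : K).
Variables (c c' s s' : 'I_5 -> K).

Definition characteristic_rows : seq (seq (option K)) :=
  let o := None in
  [:: [:: Some (c e1); Some (- alpha); o; o; o; Some (s e1); o; o; o; o];
      [:: o; Some (c e2 - alpha); o; o; o; o; Some (s e2); o; o; o];
      [:: o; Some (- alpha); Some (c e3); o; o; o; o; Some (s e3); o; o];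
      [:: o; Some (- alpha); o; Some (c e4); o; o; o; o; Some (s e4); o];
      [:: Some (c' e1); Some (c' e2); Some (c' e3); Some (c' e4); o;
          Some (s' e1); Some (s' e2 - alpha); Some (s' e3); Some (s' e4); o];
      [:: o; o; o; Some (- 1); Some (c e5); o; o; o; o; Some (s e5)];
      [:: o; o; Some alpha; Some (- 1); o; o; o; o; o; o];
      [:: o; o; o; Some (- 1); Some alpha; o; o; o; o; o];
      [:: Some (alpha * beta); o; o; Some (- 1); o; o; o; o; o; o];
      [:: o; o; o; o; Some (- c' e5); Some (alpha * beta); o; Some alpha;
          Some 1; Some (alpha - s' e5)]].

Lemma characteristic_mxE :
  characteristic_mx alpha beta c c' s s' =
  \matrix_(i, j)
    oapp id 0 (nth None (nth [::] characteristic_rows i) j).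
Proof.
apply/matrixP => i j; rewrite [LHS]mxE [RHS]mxE /vertex_forms !mxE.
(* Equalities of ordinals become equalities of numbers, which compute in each of the hundred
   cases. *)
rewrite -!(inj_eq val_inj) /=.
case: i => [[|[|[|[|[|[|[|[|[|[|i]]]]]]]]]] hi] //=;
  case: j => [[|[|[|[|[|[|[|[|[|[|j]]]]]]]]]] hj] //=;
  by rewrite ?(mulr0, mulr1, addr0, add0r, oppr0, sub0r, subr0).
Qed.

(** The inverses of [alpha] and [beta] are separate variables and sums such as [alpha + alphaV]
    stand for doubled cosines, so that the claim is polynomial modulo seven relations. *)
Lemma characteristic_identity :
    alpha * alphaV = 1 -> beta * betaV = 1 ->
    (forall j, c j * s' j - c' j * s j = 1) ->
  \det (characteristic_mx alpha beta c c' s s') =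
  - alpha ^+ 4 * beta *
  ( (s' e1 * s e2 * s e3 * s e4 + s e1 * s' e2 * s e3 * s e4
       + s e1 * s e2 * s' e3 * s e4 + s e1 * s e2 * s e3 * s' e4)
      * (c e5 + s' e5 - (alpha + alphaV))
  + (c e1 * s e3 * s e4 * s e5 + c e3 * s e1 * s e4 * s e5
       + c e4 * s e1 * s e3 * s e5 + c e5 * s e1 * s e3 * s e4)
      * (s' e2 + c e2 - (alpha + alphaV))
  + s e1 * s e2 * s e5
      * ((c' e4 * s e3 + c e4 * s' e3) + (c' e3 * s e4 + c e3 * s' e4)
           - (alpha + alphaV))
  + s e2 * s e3 * s e5
      * ((c' e1 * s e4 + c e1 * s' e4) + s' e1 * c e4
           - (alpha * beta + alphaV * betaV))
  + s e2 * s e4 * s e5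
      * (s' e1 * c e3 + c e1 * s' e3 - (beta + betaV))
  + s e1 * s e3 * s e4
      * (c e2 * s' e5 - s' e2 * c e5 - (c e2 + s' e5) * (alpha + alphaV)
           + (alpha + alphaV) ^+ 2)).
Proof.
move=> alphaK betaK wronskian; rewrite characteristic_mxE.
rewrite -(sparse_detE 10 (fun i j => nth None (nth [::] characteristic_rows i) j)).
(* The ring operations of K stay folded, for [ring] to recognise them. *)
cbv [sparse_det characteristic_rows foldr iota shift_from opt_add
  opt_signed_mul oapp nth odd negb].
(* Solved for the product [c j * s' j], the Wronskian relation serves [ring] as a rewriting rule for
   a monomial. *)
have W j : c j * s' j = 1 + c' j * s j by rewrite -(wronskian j) subrK.
ring: alphaK betaK (W e1) (W e2) (W e3) (W e4) (W e5).
Qed.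

End CharacteristicIdentity.

(** * Specialisation to the solutions at the endpoint [a] *)

Theorem theorem3p1 (R : realType) (a : R) (a_gt0 : 0 < a)
    (q : 'I_5 -> R -> R) (q_L2 : forall j, L2_interval a (q j))
    (theta1 theta2 : R)
    (theta1_bd : - pi <= theta1 <= pi) (theta2_bd : - pi <= theta2 <= pi)
    (rho : R[i])
    (C dC S dS : 'I_5 -> R -> R[i])
    (C_sol : forall j, SL_solution a (q j) (rho ^+ 2) (C j) (dC j))
    (C_init : forall j, C j 0 = 1 /\ dC j 0 = 0)
    (S_sol : forall j, SL_solution a (q j) (rho ^+ 2) (S j) (dS j))
    (S_init : forall j, S j 0 = 0 /\ dS j 0 = 1) :
  let c j := C j a in
  let c' j := dC j a in
  let s j := S j a in
  let s' j := dS j a in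
  let alpha := expi theta1 in
  let beta := expi (- theta2) in
  let cos1 := (cos theta1)%:C in
  let cos2 := (cos theta2)%:C in
  let cos12 := (cos (theta1 - theta2))%:C in
  characteristic_function theta1 theta2 c c' s s' =
  - alpha ^+ 4 * beta *
  ( (s' e1 * s e2 * s e3 * s e4 + s e1 * s' e2 * s e3 * s e4
       + s e1 * s e2 * s' e3 * s e4 + s e1 * s e2 * s e3 * s' e4)
      * (c e5 + s' e5 - 2 * cos1)
  + (c e1 * s e3 * s e4 * s e5 + c e3 * s e1 * s e4 * s e5
       + c e4 * s e1 * s e3 * s e5 + c e5 * s e1 * s e3 * s e4)
      * (s' e2 + c e2 - 2 * cos1)
  + s e1 * s e2 * s e5
      * ((c' e4 * s e3 + c e4 * s' e3) + (c' e3 * s e4 + c e3 * s' e4)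
           - 2 * cos1)
  + s e2 * s e3 * s e5
      * ((c' e1 * s e4 + c e1 * s' e4) + s' e1 * c e4 - 2 * cos12)
  + s e2 * s e4 * s e5 * (s' e1 * c e3 + c e1 * s' e3 - 2 * cos2)
  + s e1 * s e3 * s e4
      * (c e2 * s' e5 - s' e2 * c e5 - 2 * (c e2 + s' e5) * cos1
           + 4 * cos1 ^+ 2)).

Proof.
move=> c c' s s' alpha beta cos1 cos2 cos12.
have betaV : beta * expi theta2 = 1 by rewrite /beta mulrC expiNr.
have wronskian j : c j * s' j - c' j * s j = 1.
  (* The Wronskian is moved to 0, where the initial values give 1. *)
  rewrite (wronskian_constant (ltW a_gt0) (C_sol j) (S_sol j)).
  by have [-> ->] := C_init j; have [-> ->] := S_init j; rewrite !mul1r mul0r subr0.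
rewrite /characteristic_function.
rewrite (characteristic_identity (expiNr theta1) betaV wronskian).
have -> : beta + expi theta2 = 2 * cos2 by rewrite addrC expi_addN.
(* The product [alpha * beta] is the exponential of [theta1 - theta2], and the second summand is its
   inverse. *)
have -> : expi theta1 * expi (- theta2) + expi (- theta1) * expi theta2 =
    2 * cos12.
  by rewrite -!expiD -[in X in _ + X](opprK theta2) -opprD expi_addN.
rewrite expi_addN -/cos1 -/alpha -/beta.
ring.
Qed.
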